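(* Let $\mathbb{F}$ be an algebraically closed field of characteristic $2$. Every non-trivial $2$-dimensional left unital algebra over $\mathbb{F}$ is isomorphic to exactly one of the following pairwise non-isomorphic left unital algebras, given by their matrices of structure constants (MSC): \begin{itemize} \item $A_{1,2}(\alpha_1,0,\alpha_4,0)=\left(\begin{array}{cccc}\alpha_1 & 0 & 1 & \alpha_4\\ 0 & -\alpha_1 & 1-\alpha_1 & 0\end{array}\right)$, where $\alpha_1,\alpha_4\in\mathbb{F}$, $\alpha_1\neq 0$; \item $A_{2,2}(\alpha_1,0,\alpha_1)=\left(\begin{array}{cccc}\alpha_1 & 0 & 0 & 1\\ 0 & \alpha_1 & -\alpha_1+1 & 0\end{array}\right)$, where $\alpha_1\in\mathbb{F}$, $\alpha_1\neq 0$; \item $A_{3,2}(1,\beta_2)=\left(\begin{array}{cccc}1 & 1 & 1 & 0\\ 0 & \beta_2 & 0 & 1\end{array}\right)$, where $\beta_2\in\mathbb{F}$; \item $A_{4,2}(\alpha_1,\alpha_1)=\left(\begin{array}{cccc}\alpha_1 & 0 & 0 & 0\\ 0 & \alpha_1 & -\alpha_1+1 & 0\end{array}\right)$, where $\alpha_1\in\mathbb{F}$, $\alpha_1\neq 0$; \item $A_{7,2}(0)=\left(\begin{array}{cccc}0 & 1 & 1 & 0\\ 0 & 1 & 0 & -1\end{array}\right)$; \item $A_{10,2}=\left(\begin{array}{cccc}0 & 1 & 1 & 0\\ 0 & 0 & 0 & 1\end{array}\right)$. \end{itemize} (Different families, and different parameter values within a family, give non-isomorphic algebras.)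
   Context: An algebra over a field $\mathbb{F}$ is a vector space $\mathbb{A}$ with a bilinear multiplication (not assumed associative, commutative or unital). It is non-trivial if its multiplication is not identically zero. For a $2$-dimensional algebra with basis $(e_1,e_2)$, its matrix of structure constants (MSC) is the $2\times 4$ matrix $A=\left(\begin{array}{cccc}\alpha_1&\alpha_2&\alpha_3&\alpha_4\\ \beta_1&\beta_2&\beta_3&\beta_4\end{array}\right)$ over $\mathbb{F}$ with $e_1e_1=\alpha_1e_1+\beta_1e_2$, $e_1e_2=\alpha_2e_1+\beta_2e_2$, $e_2e_1=\alpha_3e_1+\beta_3e_2$, $e_2e_2=\alpha_4e_1+\beta_4e_2$; equivalently, in coordinate columns, the product of $u$ and $v$ is $A(u\otimes v)$ with $\otimes$ the Kronecker product. An algebra is identified with its MSC. Two algebras with MSCs $A$ and $B$ are isomorphic iff $B=gA(g^{-1})^{\otimes 2}$ for some $g\in GL(2;\mathbb{F})$. An algebra $\mathbb{A}$ is left unital if there is an element $\mathbf{1}_L\in\mathbb{A}$ with $\mathbf{1}_L\cdot\mathbf{u}=\mathbf{u}$ for all $\mathbf{u}\in\mathbb{A}$. The symbols $A_{i,2}(\cdot)$ are just names; the algebras meant are those given by the explicit matrices. *)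

(* Defs.v *)
From HB Require Import structures.
From mathcomp Require Import all_boot all_order all_algebra.
From mathcomp Require Export mxtens.

Set Implicit Arguments.
Unset Strict Implicit.
Unset Printing Implicit Defensive.

Import GRing.Theory.
Local Open Scope ring_scope.

Section Algebras.

Variable F : fieldType.

Definition nontrivial_alg (V : vectType F) (mul : {bilinear V -> V -> V}) : Prop :=
  exists u v : V, mul u v <> 0.

Definition left_unital (V : vectType F) (mul : {bilinear V -> V -> V}) : Prop :=
  exists e : V, forall u : V, mul e u = u.

Definition isomorphic_alg (V W : vectType F)
    (mulV : {bilinear V -> V -> V}) (mulW : {bilinear W -> W -> W}) : Prop :=
  exists phi : {linear V -> W},
    bijective phi /\ forall u v : V, phi (mulV u v) = mulW (phi u) (phi v).

(* The columns of A are the coordinates of e1e1, e1e2, e2e1, e2e2, in the order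
   in which [*t] indexes the entries of a Kronecker product. *)
Definition msc_mul (A : 'M[F]_(2, 2 * 2)) (u v : 'cV[F]_2) : 'cV[F]_2 :=
  A *m (u *t v).

Lemma msc_mul_bilinear A : bilinear_for *:%R *:%R (msc_mul A).
Proof.
split=> [v a u u' | u a v v']; rewrite /= /msc_mul scalemxAr -mulmxDr;
  congr (_ *m _); apply/matrixP=> i j; rewrite !mxE.
- by rewrite mulrDl mulrA.
- by rewrite mulrDr mulrCA.
Qed.

HB.instance Definition _ A :=
  bilinear_isBilinear.Build F 'cV[F]_2 'cV[F]_2 'cV[F]_2 *:%R *:%R (msc_mul A)
    (msc_mul_bilinear A).

Definition mk_msc (a1 a2 a3 a4 b1 b2 b3 b4 : F) : 'M[F]_(2, 2 * 2) :=
  \matrix_(i, j) (nth [::] [:: [:: a1; a2; a3; a4]; [:: b1; b2; b3; b4]] i)`_j.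

End Algebras.

Inductive lu_algebra (F : Type) : Type :=
  | A1_2 of F & F  (* A_{1,2}(alpha1, 0, alpha4, 0) *)
  | A2_2 of F      (* A_{2,2}(alpha1, 0, alpha1) *)
  | A3_2 of F      (* A_{3,2}(1, beta2) *)
  | A4_2 of F      (* A_{4,2}(alpha1, alpha1) *)
  | A7_2           (* A_{7,2}(0) *)
  | A10_2.

Arguments A7_2 {F}.
Arguments A10_2 {F}.

Definition lu_admissible (F : fieldType) (c : lu_algebra F) : Prop :=
  match c with
  | A1_2 a1 _ => a1 <> 0
  | A2_2 a1 => a1 <> 0
  | A4_2 a1 => a1 <> 0
  | A3_2 _ | A7_2 | A10_2 => True
  end.

Definition lu_msc (F : fieldType) (c : lu_algebra F) : 'M[F]_(2, 2 * 2) :=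
  match c with
  | A1_2 a1 a4 => mk_msc a1  0     1         a4
                         0   (-a1) (1 - a1)  0
  | A2_2 a1    => mk_msc a1  0     0         1
                         0   a1    (-a1 + 1) 0
  | A3_2 b2    => mk_msc 1   1     1         0
                         0   b2    0         1
  | A4_2 a1    => mk_msc a1  0     0         0
                         0   a1    (-a1 + 1) 0
  | A7_2       => mk_msc 0   1     1         0
                         0   1     0         (-1)
  | A10_2      => mk_msc 0   1     1         0
                         0   0     0         1
  end.

(* Main.v *)
From HB Require Import structures.
Require Import Defs.
From mathcomp Require Import all_boot all_order all_algebra.
From mathcomp Require Import ring.

Set Implicit Arguments.
Unset Strict Implicit.
Unset Printing Implicit Defensive.

Import GRing.Theory.
Local Open Scope ring_scope.

(* Complete a left unit [e] to a basis [e, f] with [f e = p e + q f] and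
   [f f = r e + s f].  Any two such quadruples for one algebra are related by a
   substitution [f := x f + y e], even if the left unit is not unique.  It keeps
   [q] fixed and changes the other entries to
     [p' = x p + (1 - q) y], [s' = x s + (1 + q) y],
     [r' = x^2 r + x y p + y^2 - s' y];
   in characteristic 2 it multiplies [p + s] by [x].  If [q <> 1], choose [y] to
   get [s = 0]; if [q = 1], solve a quadratic equation in [y] to get [r = 0].
   In both cases scaling by [x] then leads to one of the six families. *)

(** Reduces a goal that follows from one known equation to a polynomial identity that [ring] can
    check. *)
Lemma eq_of_subr (R : zmodType) (x y a b : R) : a = b -> x - y = a - b -> x = y.
Proof. by move=> -> /eqP; rewrite subrr subr_eq0 => /eqP. Qed.

(** * Bases adapted to a left unit, and their changes *)

Section Frames.

Variables (F : fieldType) (V : vectType F).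
Implicit Types (e f u v : V) (mul : {bilinear V -> V -> V}).

Lemma comb_eq e f a b a' b' : a = a' -> b = b' ->
  a *: e + b *: f = a' *: e + b' *: f.
Proof. by move=> -> ->. Qed.

Lemma comb10 e f : e = 1 *: e + 0 *: f.
Proof. by rewrite scale1r scale0r addr0. Qed.

Lemma comb01 e f : f = 0 *: e + 1 *: f.
Proof. by rewrite scale1r scale0r add0r. Qed.

Lemma comb_comb e f a b c d c' d' :
  a *: (c *: e + d *: f) + b *: (c' *: e + d' *: f) =
  (a * c + b * c') *: e + (a * d + b * d') *: f.
Proof. by rewrite !scalerDr !scalerDl !scalerA addrACA. Qed.

Lemma basis2_span e f : \dim {:V} = 2%N ->
  (forall u, exists a b, u = a *: e + b *: f) -> basis_of {:V} [:: e; f].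
Proof.
move=> dimV gen; rewrite basisEdim dimV leqnn andbT; apply/subvP => u _.
have [a [b ->]] := gen u.
by rewrite rpredD // rpredZ // memv_span ?mem_head // mem_behead ?mem_head.
Qed.

Lemma basis2_gen e f : basis_of {:V} [:: e; f] ->
  forall u, exists a b, u = a *: e + b *: f.
Proof.
move=> basis u.
have := coord_basis (X := [tuple e; f]) basis (memvf u).
by rewrite !big_ord_recl big_ord0 addr0 /= => ->; do 2!eexists.
Qed.

Lemma basis2_inj e f a b a' b' : basis_of {:V} [:: e; f] ->
  a *: e + b *: f = a' *: e + b' *: f -> a = a' /\ b = b'.
Proof.
move=> /basis_free /(@freeP _ _ _ [tuple e; f]) free_ef eq_comb.
pose k (i : 'I_2) := if i == 0 then a - a' else b - b'.
have k0 : forall i, k i = 0.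
  apply: free_ef; rewrite !big_ord_recl big_ord0 addr0 /k /= !scalerBl addrACA.
  by rewrite eq_comb -opprD subrr.
by split; apply/eqP; rewrite -subr_eq0; apply/eqP;
  [apply: (k0 0)|apply: (k0 1)].
Qed.

Definition is_frame mul (p q r s : F) e f : Prop :=
  [/\ basis_of {:V} [:: e; f], mul e e = e, mul e f = f,
      mul f e = p *: e + q *: f & mul f f = r *: e + s *: f].

Lemma frame_mul mul p q r s e f a b c d : is_frame mul p q r s e f ->
  mul (a *: e + b *: f) (c *: e + d *: f) =
  (a * c + b * c * p + b * d * r) *: e +
  (a * d + b * c * q + b * d * s) *: f.
Proof.
case=> _ ee ef fe ff.
rewrite linearDl !linearDr !linearZl_LR !linearZr_LR /= ee ef fe ff.
rewrite -!scalerDr !comb_comb.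
by apply: comb_eq; ring.
Qed.

Lemma frame_change mul p q r s e f x y : \dim {:V} = 2%N -> x != 0 ->
  is_frame mul p q r s e f ->
  is_frame mul (x * p + (1 - q) * y) q
    (x ^+ 2 * r + x * y * p + y ^+ 2 - (x * s + (1 + q) * y) * y)
    (x * s + (1 + q) * y) e (y *: e + x *: f).
Proof.
move=> dimV x0 frm; have [basis ee ef _ _] := frm.
have mulE := frame_mul _ _ _ _ frm; have eE := comb10 e f.
split=> //.
- apply: basis2_span => // u; have [a [b ->]] := basis2_gen basis u.
  exists (a - b / x * y), (b / x); rewrite {2}eE comb_comb.
  by apply: comb_eq; field.
- by rewrite linearDr !linearZr_LR /= ee ef.
- rewrite {2 3}eE mulE comb_comb; apply: comb_eq; ring.
- rewrite {3}eE mulE comb_comb; apply: comb_eq; ring.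
Qed.

(** Converse of [frame_change]. If [e' = e], then [y] and [x] are the coordinates of [f'] and the
    relations come from comparing coordinates. A different left unit forces a degenerate table, for
    which the relations are checked directly. *)
Lemma frame_rel mul p q r s e f p' q' r' s' e' f' :
  is_frame mul p q r s e f -> is_frame mul p' q' r' s' e' f' ->
  q' = q /\ exists x y, [/\ x != 0, p' = x * p + (1 - q) * y,
    s' = x * s + (1 + q) * y & r' = x ^+ 2 * r + x * y * p + y ^+ 2 - s' * y].
Proof.
move=> frm frm'; have [basis ee ef _ _] := frm.
have [basis' ee' ef' fe' ff'] := frm'.
have mulE := frame_mul _ _ _ _ frm.
have eE := comb10 e f; have fE := comb01 e f.
have left_unit u : mul e' u = u.
  have [a [b ->]] := basis2_gen basis' u.
  by rewrite linearDr !linearZr_LR /= ee' ef'.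
have [a [b e'E]] := basis2_gen basis e'.
have [y [x f'E]] := basis2_gen basis f'.
(* With [e' = a e + b f], the equations [e' e = e] and [e' f = f] give [a + b p = a + b s = 1] and
   [b q = b r = 0]. *)
have := left_unit e; rewrite e'E {2 3}eE mulE => /(basis2_inj basis) [abp abq].
have := left_unit f; rewrite e'E {2 3}fE mulE => /(basis2_inj basis) [abr abs].
have [b0|b0] := eqVneq b 0.
  have a1 : a = 1 by rewrite -abp b0; ring.
  have {}e'E : e' = e by rewrite e'E a1 b0 -eE.
  have x0 : x != 0.
    apply/eqP=> x0; have : 0 *: e' + 1 *: f' = y *: e' + 0 *: f'.
      by rewrite -comb01 scale0r addr0 e'E f'E x0 scale0r addr0.
    by case/(basis2_inj basis') => _ /eqP; rewrite oner_eq0.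
  move: fe' ff'; rewrite e'E f'E.
  rewrite {2 3}eE mulE comb_comb => /(basis2_inj basis) [fe1 fe2].
  rewrite {3}eE mulE comb_comb => /(basis2_inj basis) [ff1 ff2].
  move: fe1 fe2 ff1 ff2.
  rewrite !(mulr1, mulr0, mul0r, add0r, addr0) => fe1 fe2 ff1 ff2.
  have qq : q' = q by apply: (mulIf x0); rewrite -fe2 mulrC.
  split=> //; exists x, y; split=> //.
  - by apply: (eq_of_subr (esym fe1)); rewrite qq; ring.
  - by apply: (mulIf x0); apply: (eq_of_subr (esym ff2)); ring.
  - by apply: (eq_of_subr (esym ff1)); ring.
(* [e'] is a second left unit, so multiplication has the form [u v = l(u) v]. *)
move: abp abq abr abs; rewrite !(mulr1, mulr0, mul0r, add0r, addr0).
move=> abp abq abr abs.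
have q0 : q = 0 by apply: (mulfI b0); rewrite abq mulr0.
have r0 : r = 0 by apply: (mulfI b0); rewrite abr mulr0.
have sp : s = p by apply: (mulfI b0); apply: (addrI a); rewrite abs abp.
have scal v : mul f' v = (y + x * p) *: v.
  have [c [d ->]] := basis2_gen basis v.
  rewrite f'E mulE scalerDr !scalerA q0 r0 sp; apply: comb_eq; ring.
move: (fe') (ff'); rewrite !scal.
rewrite -[_ *: e']addr0 -(scale0r f') => /(basis2_inj basis') [p'E q'0].
rewrite -[_ *: f']add0r -{1}(scale0r e') => /(basis2_inj basis') [r'0 s'E].
split; first by rewrite q0 -q'0.
have s'p' : s' = p' by rewrite -s'E.
(* These are not coordinates of [f']: both tables have [q = r = 0] and [s = p], and a shift by
   [p' - p] carries one to the other. *)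
exists 1, (p' - p); split; first exact: oner_neq0.
- by rewrite q0; ring.
- by rewrite s'p' q0 sp; ring.
- by rewrite -r'0 s'p' r0; ring.
Qed.

Lemma left_unital_frame mul : \dim {:V} = 2%N -> left_unital mul ->
  exists p q r s e f, is_frame mul p q r s e f.
Proof.
move=> dimV [e eu].
have e0 : e != 0.
  apply/eqP => e0; have V0 : {:V}%VS = 0%VS.
    apply/eqP; rewrite -subv0; apply/subvP => u _.
    by rewrite memv0 -(eu u) e0 linear0l.
  by move: dimV; rewrite V0 dimv0.
have [f _ fe] : exists2 f, f \in {:V}%VS & f \notin <[e]>%VS.
  apply/subvPn/negP => /dimvS; by rewrite dimV dim_vline e0.
have basis : basis_of {:V} [:: e; f].
  rewrite basisEfree dimV subvf andbT.
  (* [free_cons] tests the head against the span of the tail, so [f] has to come first. *)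
  rewrite (perm_free (permEl (perm_catC [:: e] [:: f]))).
  by rewrite free_cons span_seq1 fe seq1_free e0.
have [p [q fe1]] := basis2_gen basis (mul f e).
have [r [s ff1]] := basis2_gen basis (mul f f).
by exists p, q, r, s, e, f; split.
Qed.

End Frames.

(** * Frames as a complete isomorphism datum *)

Section Isomorphisms.

Variables (F : fieldType) (V W : vectType F).
Variables (mulV : {bilinear V -> V -> V}) (mulW : {bilinear W -> W -> W}).

(** The linear map matching coordinates is multiplicative, since by [frame_mul] the four scalars
    determine all products. *)
Lemma frame_iso p q r s e f e' f' :
  is_frame mulV p q r s e f -> is_frame mulW p q r s e' f' ->
  isomorphic_alg mulV mulW.
Proof.
move=> frm frm'; have [basis _ _ _ _] := frm; have [basis' _ _ _ _] := frm'.
pose X := [tuple e; f]; pose Y := [tuple e'; f'].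
pose phi u := coord X 0 u *: e' + coord X 1 u *: f'.
pose psi u := coord Y 0 u *: e + coord Y 1 u *: f.
have XE u : u = coord X 0 u *: e + coord X 1 u *: f.
  have := coord_basis (X := X) basis (memvf u).
  rewrite !big_ord_recl big_ord0 addr0 /=.
  by rewrite (_ : lift ord0 ord0 = 1) //; apply: val_inj.
have YE u : u = coord Y 0 u *: e' + coord Y 1 u *: f'.
  have := coord_basis (X := Y) basis' (memvf u).
  rewrite !big_ord_recl big_ord0 addr0 /=.
  by rewrite (_ : lift ord0 ord0 = 1) //; apply: val_inj.
have phiE a b : phi (a *: e + b *: f) = a *: e' + b *: f'.
  by rewrite /phi; have /(basis2_inj basis) [<- <-] := XE (a *: e + b *: f).
have psiE a b : psi (a *: e' + b *: f') = a *: e + b *: f.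
  by rewrite /psi; have /(basis2_inj basis') [<- <-] := YE (a *: e' + b *: f').
have lin : linear phi.
  move=> k u v; rewrite /phi (linearP (coord X 0)) (linearP (coord X 1)) /=.
  rewrite !scalerDl scalerDr !scalerA.
  by rewrite addrACA.
pose Phi : {linear V -> W} :=
  HB.pack phi (GRing.isLinear.Build F V W *:%R phi lin).
exists Phi; split.
  exists psi => u /=; first by rewrite [in RHS](XE u) psiE.
  by rewrite [in RHS](YE u) phiE.
move=> u v /=; rewrite (XE u) (XE v) (frame_mul _ _ _ _ frm) !phiE.
by rewrite (frame_mul _ _ _ _ frm').
Qed.

Lemma iso_frame p q r s e' f' : \dim {:V} = 2%N ->
  isomorphic_alg mulV mulW -> is_frame mulW p q r s e' f' ->
  exists e f, is_frame mulV p q r s e f.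
Proof.
move=> dimV [phi [[psi phiK psiK] phiM]] [basis ee ef fe ff].
have phi_inj := can_inj phiK.
(* [psi] is only a set-theoretic inverse, so each identity is verified after applying the injective
   linear map [phi]. *)
exists (psi e'), (psi f'); split.
- apply: basis2_span => // u; have [a [b uE]] := basis2_gen basis (phi u).
  by exists a, b; apply: phi_inj; rewrite uE linearD !linearZ /= !psiK.
all: by apply: phi_inj; rewrite phiM ?linearD ?linearZ /= ?linearZ /= !psiK.
Qed.

End Isomorphisms.

(** * Explicit computation with structure constants *)

Section ColumnVectors.

Variable F : fieldType.

Definition col2 (a b : F) : 'cV[F]_2 := \col_i [:: a; b]`_i.

Lemma col2P (u : 'cV[F]_2) : exists a b, u = col2 a b.
Proof.
exists (u 0 0), (u 1 0); apply/matrixP => i j; rewrite !mxE ord1.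
by case: i => [[|[|//]] lt_i] /=; congr (u _ _); apply: val_inj.
Qed.

Lemma col2_comb (a b x y x' y' : F) :
  a *: col2 x y + b *: col2 x' y' = col2 (a * x + b * x') (a * y + b * y').
Proof. by apply/matrixP => i j; rewrite !mxE; case: i => [[|[|//]] lt_i]. Qed.

Lemma col2_eq (a b a' b' : F) : a = a' -> b = b' -> col2 a b = col2 a' b'.
Proof. by move=> -> ->. Qed.

Lemma msc_mul_col2 (a1 a2 a3 a4 b1 b2 b3 b4 x y x' y' : F) :
  msc_mul (mk_msc a1 a2 a3 a4 b1 b2 b3 b4) (col2 x y) (col2 x' y') =
  col2 (a1 * (x * x') + a2 * (x * y') + a3 * (y * x') + a4 * (y * y'))
       (b1 * (x * x') + b2 * (x * y') + b3 * (y * x') + b4 * (y * y')).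
Proof.
apply/matrixP => i j; rewrite !mxE.
(* The four columns are indexed by pairs, so that the entries of the Kronecker product factor. *)
rewrite (reindex (@mxtens_index 2 2)) /=; last first.
  by exists (@mxtens_unindex 2 2) => k _;
    rewrite ?mxtens_indexK ?mxtens_unindexK.
pose G k l := mk_msc a1 a2 a3 a4 b1 b2 b3 b4 i (mxtens_index (k, l)) *
  (col2 x y *t col2 x' y') (mxtens_index (k, l)) j.
rewrite (eq_bigr (fun kl => G kl.1 kl.2)); last by case.
rewrite -(pair_bigA _ G) {}/G /=.
rewrite !big_ord_recl !big_ord0 !mxE !mxtens_indexK /= !addr0 !addrA.
by case: i => [[|[|//]] lt_i].
Qed.

Lemma dim_cV2 : \dim {:'cV[F]_2} = 2%N.
Proof. by rewrite dimvf dim_matrix. Qed.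

Lemma msc_frame (a1 a2 a3 a4 b1 b2 b3 b4 x y x' y' p q r s : F) :
  x * y' - x' * y != 0 ->
  let A := mk_msc a1 a2 a3 a4 b1 b2 b3 b4 in
  let e := col2 x y in let f := col2 x' y' in
  msc_mul A e e = e -> msc_mul A e f = f ->
  msc_mul A f e = p *: e + q *: f -> msc_mul A f f = r *: e + s *: f ->
  is_frame (msc_mul A) p q r s e f.
Proof.
move=> det0 A e f ee ef fe ff; split=> //.
apply: basis2_span; first exact: dim_cV2.
move=> u; have [a [b ->]] := col2P u.
(* Cramer's rule. *)
exists ((a * y' - x' * b) / (x * y' - x' * y)),
  ((x * b - a * y) / (x * y' - x' * y)).
by rewrite col2_comb; apply: col2_eq; field.
Qed.

End ColumnVectors.

(** * Normal forms of frames in characteristic 2 *)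

Section Classification.

Variable F : closedFieldType.
Hypothesis char2 : 2%N \in [pchar F].

Definition has_frame (V : vectType F) (mul : {bilinear V -> V -> V})
    (d : F * F * F * F) : Prop :=
  let: (p, q, r, s) := d in exists e f, is_frame mul p q r s e f.

(* [(p, q, r, s)] for [e := e1 / a1] and [f := e2] in [A1_2], [A2_2] and [A4_2],
   and for [e := e2] and [f := e1] in the other cases. *)
Definition lu_data (c : lu_algebra F) : F * F * F * F :=
  match c with
  | A1_2 a1 a4 => (1, a1^-1 - 1, a4 * a1, 0)
  | A2_2 a1 => (0, a1^-1 - 1, a1, 0)
  | A3_2 b2 => (b2, 1, 0, 1)
  | A4_2 a1 => (0, a1^-1 - 1, 0, 0)
  | A7_2 => (1, 1, 0, 0)
  | A10_2 => (0, 1, 0, 0)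
  end.

Lemma lu_msc_frame c : lu_admissible c ->
  has_frame (msc_mul (lu_msc c)) (lu_data c).
Proof.
(* For the chosen [e], the unit law in [A1_2] and [A7_2] depends on [-1 = 1]: there [e f = - f] and
   [e e = - e] respectively. *)
have opp x : - x = x :> F by exact: oppr_pchar2.
case: c => [a1 a4|a1|b2|a1||] /= adm.
- exists (col2 a1^-1 0), (col2 0 1); move/eqP: adm => a10.
  by apply: msc_frame; [by rewrite mul0r mulr1 subr0 invr_eq0|..];
    rewrite msc_mul_col2 ?col2_comb ?opp; apply: col2_eq; field.
- exists (col2 a1^-1 0), (col2 0 1); move/eqP: adm => a10.
  by apply: msc_frame; [by rewrite mul0r mulr1 subr0 invr_eq0|..];
    rewrite msc_mul_col2 ?col2_comb; apply: col2_eq; field.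
- exists (col2 0 1), (col2 1 0).
  by apply: msc_frame; [by rewrite mul0r sub0r mulr1 opp oner_neq0|..];
    rewrite msc_mul_col2 ?col2_comb; apply: col2_eq; ring.
- exists (col2 a1^-1 0), (col2 0 1); move/eqP: adm => a10.
  by apply: msc_frame; [by rewrite mul0r mulr1 subr0 invr_eq0|..];
    rewrite msc_mul_col2 ?col2_comb; apply: col2_eq; field.
- exists (col2 0 1), (col2 1 0).
  by apply: msc_frame; [by rewrite mul0r sub0r mulr1 opp oner_neq0|..];
    rewrite msc_mul_col2 ?col2_comb ?opp; apply: col2_eq; ring.
- exists (col2 0 1), (col2 1 0).
  by apply: msc_frame; [by rewrite mul0r sub0r mulr1 opp oner_neq0|..];
    rewrite msc_mul_col2 ?col2_comb; apply: col2_eq; ring.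
Qed.

Lemma quadratic_root (b c : F) : exists y, y ^+ 2 + b * y + c = 0.
Proof.
(* [solve_monicpoly] expresses the leading power by the lower terms, hence the signs; [ltn0Sn 1]
   sets the degree to 2. *)
pose a i := if i == 0%N then - c else - b.
have [y yE] := solve_monicpoly a (ltn0Sn 1).
by exists y; rewrite yE !big_ord_recl big_ord0 /a /= expr0 expr1; ring.
Qed.

Lemma frame_lu_data (V : vectType F) (mul : {bilinear V -> V -> V})
    p q r s e f :
  \dim {:V} = 2%N -> is_frame mul p q r s e f ->
  exists2 c, lu_admissible c & has_frame mul (lu_data c).
Proof.
move=> dimV frm.
have opp x : - x = x :> F by exact: oppr_pchar2.
have two : 1 + 1 = 0 :> F by exact: addrr_pchar2.
have change x y p' r' s' : x != 0 -> x * p + (1 - q) * y = p' ->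
    x * s + (1 + q) * y = s' ->
    x ^+ 2 * r + x * y * p + y ^+ 2 - s' * y = r' ->
    has_frame mul (p', q, r', s').
  by move=> x0 <- s'E <-; rewrite -s'E; do 2!eexists; apply: frame_change frm.
have [q1|q1] := eqVneq q 1.
  (* For [q = 1] the shift [y] drops out of [p'] and [s'], so it is free to solve [r' = 0], while
     [x] scales [p] and [s] together. *)
  have solve x : x != 0 -> has_frame mul (x * p, 1, 0, x * s).
    move=> x0; have [y yE] := quadratic_root (x * p - x * s) (x ^+ 2 * r).
    rewrite -[X in (_, X, _, _)]q1; apply: (change x y) => //.
    - by rewrite q1; ring.
    - by rewrite q1 two; ring.
    - by rewrite -[RHS]yE; ring.
  have [s0|s0] := eqVneq s 0; last first.
    exists (A3_2 (s^-1 * p)) => //=.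
    by have := solve s^-1; rewrite invr_eq0 mulVf //; apply.
  have [p0|p0] := eqVneq p 0.
    exists A10_2 => //=.
    by have := solve 1 (oner_neq0 _); rewrite p0 s0 !mulr0.
  exists A7_2 => //=.
  by have := solve p^-1; rewrite invr_eq0 s0 mulr0 mulVf //; apply.
have q1' : 1 + q != 0 by rewrite addrC -[1]opp subr_eq0.
(* In [lu_data] the parameter satisfies [a1^-1 - 1 = q], which dictates [a1 = (1 + q)^-1]. *)
have qE : q = (1 + q)^-1^-1 - 1 by rewrite invrK; ring.
have adm : (1 + q)^-1 <> 0 by apply/eqP; rewrite invr_eq0.
(* The shift by [t] kills [s]; as [1 - q = 1 + q], it also turns [p] into [p - s]. *)
pose t := - s / (1 + q).
have tE : s + (1 + q) * t = 0 by rewrite /t; field.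
have tE' : p + (1 - q) * t = p - s.
  by rewrite opp -[RHS]addr0 -tE; ring.
have norm x : x != 0 ->
    has_frame mul (x * (p - s), q, x ^+ 2 * (r + t * p + t ^+ 2), 0).
  move=> x0; apply: (change x (x * t)) => //.
  - by rewrite -tE'; ring.
  - by rewrite -[RHS](mulr0 x) -tE; ring.
  - by ring.
have [ps|ps] := eqVneq (p - s) 0; last first.
  (* This scaling makes [p] equal to 1; the division by [a1] undoes the factor in the entry
     [a4 * a1] of [lu_data]. *)
  pose x := (p - s)^-1; pose a1 := (1 + q)^-1.
  exists (A1_2 a1 (x ^+ 2 * (r + t * p + t ^+ 2) / a1)) => //=.
  rewrite -qE divfK; last exact/eqP.
  by have := norm x; rewrite invr_eq0 mulVf //; apply.
have [r0|r0] := eqVneq (r + t * p + t ^+ 2) 0.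
  exists (A4_2 (1 + q)^-1) => //=; rewrite -qE.
  by have := norm 1 (oner_neq0 _); rewrite ps r0 !mulr0.
(* A square root chosen so that the scaled [r] equals [a1], as [A2_2] requires. *)
have [x] := quadratic_root 0 (- ((1 + q)^-1 / (r + t * p + t ^+ 2))).
rewrite mul0r addr0 => /eqP; rewrite subr_eq0 => /eqP xE.
have x0 : x != 0.
  have : x ^+ 2 != 0 by rewrite xE mulf_neq0 // invr_eq0.
  by rewrite expf_eq0.
exists (A2_2 (1 + q)^-1) => //=.
by have := norm x x0; rewrite -qE ps mulr0 xE divfK.
Qed.

(** Eliminates [y] from [frame_rel]: in [p' + s'] its coefficient is [(1 - q) + (1 + q) = 0]; for
    [q = 1] both of its coefficients vanish; for [q <> 1] and [s = s' = 0], the equation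
    [(1 + q) y = 0] forces [y = 0]. *)
Lemma frame_invariants (V : vectType F) (mul : {bilinear V -> V -> V})
    p q r s e f p' q' r' s' e' f' :
  is_frame mul p q r s e f -> is_frame mul p' q' r' s' e' f' ->
  exists x, [/\ x != 0, q' = q, p' + s' = x * (p + s),
    q = 1 -> p' = x * p /\ s' = x * s &
    q <> 1 -> s = 0 -> s' = 0 -> p' = x * p /\ r' = x ^+ 2 * r].
Proof.
move=> frm frm'; have [qq [x [y [x0 pE sE rE]]]] := frame_rel frm frm'.
have opp z : - z = z :> F by exact: oppr_pchar2.
exists x; split=> //.
- rewrite pE sE opp; apply: (eq_of_subr (addrr_pchar2 char2 ((1 + q) * y))).
  by ring.
- by move=> q1; rewrite pE sE q1 opp (addrr_pchar2 char2) mul0r !addr0.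
move=> q1 s0 s'0; have y0 : y = 0.
  apply/eqP; move/eqP: sE; rewrite s0 s'0 mulr0 add0r eq_sym mulf_eq0.
  by rewrite addrC -[1]opp subr_eq0 => /orP[/eqP|].
by rewrite pE rE s'0 y0; split; ring.
Qed.

(** Whether [q = 1] separates [A3_2], [A7_2], [A10_2] from the rest. For [q = 1], vanishing of [s]
    isolates [A3_2], and [p] separates the other two. For [q <> 1], vanishing of [p + s] and then of
    [r] separates the families, and [q] determines [a1]. The entry [p = 1] of [A1_2] and the entry
    [s = 1] of [A3_2] force [x = 1], which fixes the remaining parameter. *)
Lemma lu_data_inj (V : vectType F) (mul : {bilinear V -> V -> V}) c c' :
  lu_admissible c -> lu_admissible c' ->
  has_frame mul (lu_data c) -> has_frame mul (lu_data c') -> c = c'.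
Proof.
have inv_eq1 (a : F) : a <> 0 -> a^-1 - 1 <> 1.
  move=> a0 /eqP; rewrite subr_eq (addrr_pchar2 char2) invr_eq0.
  by move/eqP.
have one0 := oner_eq0 F.
(* The successive [try] clauses exclude unequal [q], exclude [p + s] being 0 on one side and 1 on
   the other, and extract the equality of the [a1] parameters. *)
case: c c' => [a1 a4|a|b2|a||] [a1' a4'|a'|b2'|a'||] //= adm adm'
  [e [f frm]] [e' [f' frm']];
  have [x [x0 qE psE at1 not1]] := frame_invariants frm frm';
  try (by case: (inv_eq1 _ adm)); try (by case: (inv_eq1 _ adm'));
  try (by move/eqP: psE;
    rewrite ?addr0 ?mulr1 ?mulr0 ?(negPf x0) ?one0 // eq_sym (negPf x0));
  try (have aE := invr_inj (addIr _ qE)).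
- have [|//|//|xE rE] := not1; first exact: inv_eq1.
  have x1 : x = 1 by rewrite -[x]mulr1 -xE.
  move: rE; rewrite x1 expr1n mul1r -aE => /mulIf -> //; exact/eqP.
- by rewrite aE.
- have [|//|//|_ /esym/eqP] := not1; first exact: inv_eq1.
  by rewrite mulf_eq0 expf_eq0 (negPf x0) => /eqP.
- have [//|pE xE] := at1.
  by rewrite pE -[x]mulr1 -xE mul1r.
- have [//|_ /esym/eqP] := at1.
  by rewrite mulr1 (negPf x0).
- have [//|_ /esym/eqP] := at1.
  by rewrite mulr1 (negPf x0).
- have [|//|//|_] := not1; first exact: inv_eq1.
  by rewrite mulr0.
- by rewrite aE.
- by have [//|_ /eqP] := at1; rewrite mulr0 one0.
- by have [//|_ /eqP] := at1; rewrite mulr0 one0.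
Qed.
End Classification.

Theorem theorem3p2 (F : closedFieldType) (hchar : 2%N \in [pchar F]) :
  (forall (V : vectType F) (mul : {bilinear V -> V -> V}),
     \dim {:V} = 2%N -> nontrivial_alg mul -> left_unital mul ->
     exists! c : lu_algebra F,
       lu_admissible c /\ isomorphic_alg mul (msc_mul (lu_msc c))) /\
  (forall c : lu_algebra F, lu_admissible c -> left_unital (msc_mul (lu_msc c))) /\
  (forall c c' : lu_algebra F, lu_admissible c -> lu_admissible c' ->
     isomorphic_alg (msc_mul (lu_msc c)) (msc_mul (lu_msc c')) -> c = c').
Proof.
(* Moving the frame of a normal form to [mul] puts the data to be compared on one algebra, where
   [lu_data_inj] applies. *)
have pull_back (V : vectType F) (mul : {bilinear V -> V -> V}) c :
    \dim {:V} = 2%N -> lu_admissible c ->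
    isomorphic_alg mul (msc_mul (lu_msc c)) -> has_frame mul (lu_data c).
  move=> dimV /(lu_msc_frame hchar); case: (lu_data c) => [[[p q] r] s].
  by case=> e [f frm] iso; apply: iso_frame frm.
split=> [V mul dimV _ lu|]; last split.
- have [p [q [r [s [e [f frm]]]]]] := left_unital_frame dimV lu.
  have [c adm frm_c] := frame_lu_data hchar dimV frm.
  exists c; split=> [|c' [adm' iso]].
    split=> //; have := lu_msc_frame hchar adm; move: frm_c.
    case: (lu_data c) => [[[p1 q1] r1] s1] [e1 [f1 frm1]] [e2 [f2 frm2]].
    exact: frame_iso frm1 frm2.
  by apply: lu_data_inj frm_c _ => //; apply: pull_back.
- move=> c /(lu_msc_frame hchar); case: (lu_data c) => [[[p q] r] s].
  case=> e [f [basis ee ef _ _]]; exists e => u.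
  have [a [b ->]] := basis2_gen basis u.
  by rewrite linearDr !linearZr_LR /= ee ef.
(* The common algebra is here the first normal form itself. *)
move=> c c' adm adm' iso; apply: (lu_data_inj hchar adm adm').
  exact: lu_msc_frame.
exact: pull_back (dim_cV2 F) adm' iso.
Qed.
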